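(* Let $m\ge 2$, let $r_1,\ldots,r_m$ be positive integers, and let $k$ be a positive integer. The weighted star matrix $B(k;r_1,\ldots,r_m)$ is of affine type if and only if $$\sum_{i=1}^m \frac{1}{r_i+1}=m-k.$$ In particular, for fixed $m\ge 2$ and $k\ge 1$, putting $p=m-k$, the assignment $(r_1,\ldots,r_m)\mapsto (r_1+1,\ldots,r_m+1)$ is a bijection between the tuples of positive integers $(r_1,\ldots,r_m)$ for which $B(k;r_1,\ldots,r_m)$ is of affine type and the tuples of integers $(N_1,\ldots,N_m)$ with all $N_i\ge 2$ and $\sum_{i=1}^m \frac{1}{N_i}=p$.
   Context: For a positive integer $r$, $A_r$ denotes the Cartan matrix of type $A_r$: the $r\times r$ tridiagonal matrix with all diagonal entries equal to $2$ and all entries immediately above and below the diagonal equal to $-1$ (so $A_1=(2)$). For each $i$, let $v_i\in\mathbb{Z}^{r_i}$ be the column vector whose entries are all zero except the last one, which is $-1$. The weighted star matrix is the symmetric integer matrix of size $1+\sum_{i=1}^m r_i$ $$B(k;r_1,\ldots,r_m)=\begin{pmatrix} A_{r_1}&0&\cdots&0&v_1\\ 0&A_{r_2}&\cdots&0&v_2\\ \vdots&\vdots&\ddots&\vdots&\vdots\\ 0&0&\cdots&A_{r_m}&v_m\\ v_1^t&v_2^t&\cdots&v_m^t&k\end{pmatrix}.$$ Such a matrix is said to be of affine type if it is positive semidefinite of corank one (its kernel is one-dimensional) and every proper principal submatrix is positive definite. *)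

(* Defs.v *)
From mathcomp Require Import all_boot all_order all_algebra.
From mathcomp Require Export boolp classical_sets functions.

Set Implicit Arguments.
Unset Strict Implicit.
Unset Printing Implicit Defensive.

Import Order.TTheory GRing.Theory Num.Theory.

Local Open Scope ring_scope.

Definition cartanA (r : nat) : 'M[int]_r :=
  \matrix_(a < r, b < r)
    if a == b then 2
    else if (a.+1 == b :> nat) || (b.+1 == a :> nat) then -1
    else 0.

Definition last_negv (r : nat) : 'cV[int]_r :=
  \col_(a < r) if a.+1 == r :> nat then -1 else 0.

Definition weighted_star (m : nat) (k : int) (r : 'I_m -> nat) :
    'M[int]_(\sum_(i < m) r i + 1) :=
  block_mx (\mxdiag_(i < m) cartanA (r i)) (\mxcol_(i < m) last_negv (r i))
           (\mxrow_(i < m) (last_negv (r i))^T) k%:M.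

Section AffineType.
Variable R : realFieldType.

Definition quad_form (n : nat) (A : 'M[R]_n) (x : 'cV[R]_n) : R :=
  (x^T *m A *m x) 0 0.

Definition pos_semidefinite (n : nat) (A : 'M[R]_n) : Prop :=
  A^T = A /\ forall x : 'cV[R]_n, 0 <= quad_form A x.

Definition pos_definite (n : nat) (A : 'M[R]_n) : Prop :=
  A^T = A /\ forall x : 'cV[R]_n, x != 0 -> 0 < quad_form A x.

(* The order of the rows kept is that of 'I_n, since enum_val is increasing. *)
Definition principal_submx (n : nat) (S : {set 'I_n}) (A : 'M[R]_n) :
    'M[R]_#|S| :=
  mxsub (@enum_val _ (mem S)) (@enum_val _ (mem S)) A.

(* kermx is the left kernel; for a symmetric matrix it is, up to
   transposition, the usual kernel. For S = set0 the positivity condition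
   holds vacuously. *)
Definition affine_type (n : nat) (A : 'M[R]_n) : Prop :=
  [/\ pos_semidefinite A,
      \rank (kermx A) = 1%N &
      forall S : {set 'I_n}, S \proper [set: 'I_n] ->
        pos_definite (principal_submx S A)].

End AffineType.

(* Main.v *)
Require Import Defs.
From mathcomp Require Import all_boot all_order all_algebra.
From mathcomp Require Import boolp classical_sets functions.
From mathcomp Require Import ring lra.

Import Order.TTheory GRing.Theory Num.Theory.
Local Open Scope classical_set_scope.
Local Open Scope ring_scope.

(** The quadratic form of a star is a sum of squares plus one square with a
    coefficient of either sign.  On an arm with entries x_1, ..., x_r, put
    x_0 = 0 and let x_(r+1) = y be the coordinate of the hub.  Summation by
    parts turns the contribution of the arm (its Cartan block and its link to
    the hub) into the sum of the r + 1 squared increments x_(a+1) - x_a, minus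
    y^2 ([cartan_form]).  These increments add up to y, so splitting off their
    mean s_i = y / (r_i + 1) extracts y^2 / (r_i + 1) ([sum_sqr_increments]).
    Adding the arms and the term k y^2 ([star_formE]),

      q(x) = sum_i sum_a (x_(i,a+1) - x_(i,a) - s_i)^2 + y^2 d

    where d = sum_i 1 / (r_i + 1) - (m - k) is the [star_defect].  All the
    squares in the double sum vanish exactly on the line spanned by the vector
    u that grows linearly from 0 to 1 along each arm ([star_null]); it has
    positive entries and q(u) = d.

    If the matrix is of affine type, then d = q(u) >= 0.  A kernel vector x <> 0
    has q(x) = 0, hence is y u, with y <> 0 and y^2 d = 0; so d = 0.
    Conversely, if d = 0 then q is nonnegative and its isotropic vectors are the
    multiples of u.  As u has no zero entry, this is affine type
    ([affine_type_isotropic]): the kernel is the isotropic line, and an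
    isotropic vector supported on a proper subset of the coordinates is 0.

    The bijection is then the shift by one, under which the two descriptions of
    the tuples are the same equation. *)

(** * Positive semidefinite forms and affine type *)

Lemma quad_form_line (R : realFieldType) n (A : 'M[R]_n) (x z : 'cV[R]_n) (t : R) :
  A^T = A ->
  quad_form A (x + t *: z) =
    quad_form A x + t * (z^T *m (A *m x)) 0 0 *+ 2 + t ^+ 2 * quad_form A z.
Proof.
move=> symA.
have xAz : (x^T *m (A *m z)) 0 0 = (z^T *m (A *m x)) 0 0.
  have -> : x^T *m (A *m z) = (z^T *m (A *m x))^T.
    by rewrite !trmx_mul trmxK symA mulmxA.
  by rewrite mxE.
have trE : (x + t *: z)^T = x^T + t *: z^T by apply/matrixP=> i j; rewrite !mxE.
rewrite /quad_form trE !mulmxDl -!mulmxA !mulmxDr -!scalemxAl -!scalemxAr.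
have mxD (M N : 'M[R]_1) : (M + N) 0 0 = M 0 0 + N 0 0 by rewrite mxE.
have mxZ a (M : 'M[R]_1) : (a *: M) 0 0 = a * M 0 0 by rewrite mxE.
by rewrite !(mxD, mxZ) xAz; ring.
Qed.

Lemma quad_formZ (R : realFieldType) n (A : 'M[R]_n) (x : 'cV[R]_n) (c : R) :
  quad_form A (c *: x) = c ^+ 2 * quad_form A x.
Proof.
have trE : (c *: x)^T = c *: x^T by apply/matrixP=> i j; rewrite !mxE.
rewrite /quad_form trE -!scalemxAl -scalemxAr scalerA -expr2.
by rewrite [in LHS]mxE.
Qed.

(** Along the line x + t z the form is a nonnegative polynomial in t without
    constant term, so its linear coefficient, twice z^T A x, is 0. *)
Lemma psd_isotropic_ker (R : realFieldType) n (A : 'M[R]_n) (x : 'cV[R]_n) :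
  pos_semidefinite A -> quad_form A x = 0 -> A *m x = 0.
Proof.
move=> [symA psdA] qx0.
suff ortho (z : 'cV[R]_n) : (z^T *m (A *m x)) 0 0 = 0.
  apply/colP=> i; rewrite [RHS]mxE -(ortho (delta_mx i 0)).
  by rewrite trmx_delta -rowE [RHS]mxE.
set b : R := (_ *m _) 0 0; set q := quad_form A z.
have q_ge0 : 0 <= q by exact: psdA.
(* The parabola 2 b t + q t^2 has its vertex at t = - b / q; dividing by q + 1
   instead still gives a negative value when b != 0, and also covers q = 0. *)
have := psdA (x + (- b / (q + 1)) *: z).
rewrite quad_form_line // qx0 add0r -/b -/q => qt_ge0.
have q1_gt0 : 0 < q + 1 by lra.
have q1_neq0 : q + 1 != 0 by rewrite gt_eqF.
have vertexE : - b / (q + 1) * b *+ 2 + (- b / (q + 1)) ^+ 2 * q =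
    - ((b / (q + 1)) ^+ 2 * (q + 2)) by field.
move: qt_ge0; rewrite vertexE oppr_ge0 => le0.
have: (b / (q + 1)) ^+ 2 * (q + 2) = 0.
  by apply/eqP; rewrite eq_le le0 mulr_ge0 ?sqr_ge0 //; lra.
move/eqP; rewrite mulf_eq0 expf_eq0 /= mulf_eq0 invr_eq0 (negPf q1_neq0) orbF.
by case/orP=> /eqP //; lra.
Qed.

(** The kernel of a semidefinite matrix consists of its isotropic vectors, so it
    is the line of u.  A vector of a proper principal submatrix, extended by
    zeros, lies on that line only if it is 0, because it has a zero coordinate
    and u has none. *)
Lemma affine_type_isotropic (R : realFieldType) n (A : 'M[R]_n) (u : 'cV[R]_n) :
  (0 < n)%N -> pos_semidefinite A -> (forall i, u i 0 != 0) ->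
  (forall x, quad_form A x = 0 <-> exists c, x = c *: u) ->
  affine_type A.
Proof.
move=> n_gt0 psdA u_neq0 isoA; have [symA qA_ge0] := psdA; split=> //.
  have uT_neq0 : u^T != 0.
    apply: contra_neq (u_neq0 (Ordinal n_gt0)) => uT0.
    by rewrite -[u]trmxK uT0 !mxE.
  have <- : \rank u^T = 1%N by rewrite rank_rV uT_neq0.
  apply/eqP; rewrite eqn_leq; apply/andP; split; apply: mxrankS.
    apply/row_subP=> i; set w := row i _.
    have wA : w *m A = 0 by rewrite -row_mul mulmx_ker row0.
    have /isoA[c wE] : quad_form A w^T = 0.
      by rewrite /quad_form trmxK wA mul0mx mxE.
    by rewrite -[w]trmxK wE linearZ scalemx_sub.
  apply/sub_kermxP; rewrite -symA -trmx_mul psd_isotropic_ker ?trmx0 //.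
  by apply/isoA; exists 1; rewrite scale1r.
move=> S /properP[_ [j _ jS]]; split.
  by apply/matrixP=> a b; rewrite !mxE -[in LHS]symA mxE.
move=> x x_neq0; set g := @enum_val _ (mem S).
have g_inj : injective g by exact: enum_val_inj.
(* E x is the extension of x by zeros outside S. *)
pose E : 'M[R]_(n, #|S|) := \matrix_(i, a) (i == g a)%:R.
have Ex_j : (E *m x) j 0 = 0.
  rewrite mxE big1 // => a _; rewrite mxE; case: eqP => [ja|_]; last by rewrite mul0r.
  by move: jS; rewrite ja enum_valP.
have EE : E^T *m E = 1%:M.
  apply/matrixP=> a b; rewrite mxE (bigD1 (g a)) //= !mxE eqxx mul1r big1 ?addr0.
    by rewrite (inj_eq g_inj).
  by move=> i ia; rewrite !mxE (negPf ia) mul0r.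
have subE : principal_submx S A = E^T *m A *m E.
  apply/matrixP=> a b; rewrite !mxE (bigD1 (g b)) //= !mxE eqxx mulr1.
  rewrite [X in _ = _ + X]big1 ?addr0; last first.
    by move=> i ib; rewrite [E _ _]mxE (negPf ib) mulr0.
  rewrite (bigD1 (g a)) //= !mxE eqxx mul1r big1 ?addr0 // => i ia.
  by rewrite !mxE (negPf ia) mul0r.
have -> : quad_form (principal_submx S A) x = quad_form A (E *m x).
  by rewrite /quad_form subE trmx_mul !mulmxA.
rewrite lt_def qA_ge0 andbT; apply: contra_neq x_neq0 => /isoA[c Exu].
have c0 : c = 0.
  move: Ex_j; rewrite Exu mxE => /eqP.
  by rewrite mulf_eq0 (negPf (u_neq0 j)) orbF => /eqP.
by rewrite -[x]mul1mx -EE -mulmxA Exu c0 scale0r mulmx0.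
Qed.

(** * The quadratic form of an arm *)

Lemma summation_by_parts (R : comPzRingType) (f : nat -> R) r :
  f 0 = 0 ->
  \sum_(a < r) f a.+1 * (f a.+1 *+ 2 - f a - f a.+2) =
    \sum_(a < r.+1) (f a.+1 - f a) ^+ 2 - f r.+1 ^+ 2 + f r * f r.+1.
Proof.
move=> f0; elim: r => [|r IHr]; first by rewrite big_ord1 big_ord0 f0; ring.
by rewrite big_ord_recr /= IHr [in RHS]big_ord_recr /=; ring.
Qed.

Lemma sum_last (R : pzRingType) (f : nat -> R) r :
  f 0 = 0 -> \sum_(a < r) (a.+1 == r :> nat)%:R * f a.+1 = f r.
Proof.
move=> f0; case: r => [|r]; first by rewrite big_ord0.
rewrite big_ord_recr /= eqxx mul1r big1 ?add0r // => a _.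
by rewrite eqSS ltn_eqF ?mul0r.
Qed.

(** The Cartan matrix is the discrete Laplacian - f'' with value 0 imposed at
    both ends; f is free at r + 1, and the last term corrects for this. *)
Lemma cartanA_mul (R : comNzRingType) (f : nat -> R) r (a : 'I_r) :
  f 0 = 0 ->
  (map_mx intr (cartanA r) *m (\col_(b < r) f b.+1)) a 0 =
    f a.+1 *+ 2 - f a - f a.+2 + (a.+1 == r :> nat)%:R * f r.+1.
Proof.
move=> f0; rewrite mxE.
pose F c := \sum_(b < r) (b == c :> nat)%:R * f b.+1.
have FE c : F c = if (c < r)%N then f c.+1 else 0.
  rewrite -(big_ord1_eq +%R (fun b => f b.+1)) big_mkcond; apply: eq_bigr => b _.
  by case: eqP => _; rewrite ?mul1r ?mul0r.
have -> : \sum_j map_mx intr (cartanA r) a j * (\col_(b < r) f b.+1) j 0 =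
    F a *+ 2 - F a.+1 - \sum_(b < r) (b.+1 == a :> nat)%:R * f b.+1.
  rewrite /F -sumrMnl -!sumrB; apply: eq_bigr => b _; rewrite !mxE -val_eqE /=.
  rewrite [(b : nat) == a]eq_sym [(b : nat) == a.+1]eq_sym.
  case: (ltngtP a b) => [ab|ba|->].
  - rewrite (gtn_eqF (leqW ab)) orbF.
    by case: eqP => _ /=; rewrite ?rmorphN ?rmorph1 ?rmorph0; ring.
  - rewrite (gtn_eqF (leqW ba)) /=.
    by case: eqP => _ /=; rewrite ?rmorphN ?rmorph1 ?rmorph0; ring.
  - by rewrite gtn_eqF //=; ring.
have -> : \sum_(b < r) (b.+1 == a :> nat)%:R * f b.+1 = f a.
  case: a => -[|a] /= ar; first by rewrite big1 // => b _; rewrite mul0r.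
  by under eq_bigr do rewrite eqSS; rewrite -/(F a) FE (ltnW ar).
rewrite !FE ltn_ord.
case: (ltngtP a.+1 r) (ltn_ord a) => [_ _|//|ar _] /=; first by ring.
have -> : f r.+1 = f a.+2 by rewrite ar.
by ring.
Qed.

(** An arm with its link to the hub is a path of r + 1 edges from 0 to the value
    f (r + 1) at the hub, and its form is the Dirichlet energy of f up to the
    square at the hub; the link term cancels the boundary term of the summation
    by parts. *)
Lemma cartan_form (R : realFieldType) (f : nat -> R) r :
  f 0 = 0 ->
  quad_form (map_mx intr (cartanA r)) (\col_(a < r) f a.+1)
    + f r.+1 * ((map_mx intr (last_negv r))^T *m \col_(a < r) f a.+1) 0 0 *+ 2 =
  \sum_(a < r.+1) (f a.+1 - f a) ^+ 2 - f r.+1 ^+ 2.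
Proof.
move=> f0.
have -> : quad_form (map_mx intr (cartanA r)) (\col_(a < r) f a.+1) =
    \sum_(a < r) f a.+1 * (f a.+1 *+ 2 - f a - f a.+2) + f r.+1 * f r.
  rewrite /quad_form -mulmxA mxE -[in RHS](@sum_last _ f r) // mulr_sumr.
  rewrite -big_split /=; apply: eq_bigr => a _.
  by rewrite cartanA_mul // !mxE; ring.
have -> : ((map_mx intr (last_negv r))^T *m \col_(a < r) f a.+1) 0 0 = - f r.
  rewrite mxE -[in RHS](@sum_last _ f r) // -sumrN; apply: eq_bigr => a _.
  by rewrite !mxE; case: eqP => _; rewrite ?rmorphN ?rmorph1 ?rmorph0; ring.
by rewrite summation_by_parts //; ring.
Qed.

(** The n increments have mean f n / n: this is the decomposition of a second
    moment into variance and squared mean. *)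
Lemma sum_sqr_increments (R : fieldType) (f : nat -> R) n :
  f 0 = 0 -> n%:R != 0 :> R ->
  \sum_(a < n) (f a.+1 - f a) ^+ 2 =
    \sum_(a < n) (f a.+1 - f a - f n / n%:R) ^+ 2 + f n ^+ 2 / n%:R.
Proof.
move=> f0 n_neq0; set s := f n / n%:R.
have tele : \sum_(a < n) (f a.+1 - f a) = f n.
  by rewrite -(big_mkord xpredT (fun a => f a.+1 - f a)) telescope_sumr // f0 subr0.
rewrite (eq_bigr (fun a : 'I_n => (f a.+1 - f a - s) ^+ 2
    + ((f a.+1 - f a) * (s *+ 2) - s ^+ 2))); last by move=> a _; ring.
rewrite big_split /= sumrB -mulr_suml tele sumr_const card_ord -[_ *+ n]mulr_natl.
by congr (_ + _); rewrite /s; field.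
Qed.

Lemma constant_increments (R : pzRingType) (f : nat -> R) n s :
  f 0 = 0 -> (forall a : 'I_n, f a.+1 - f a = s) ->
  forall a, (a <= n)%N -> f a = a%:R * s.
Proof.
move=> f0 fs; elim=> [_|a IHa an]; first by rewrite f0 mul0r.
have /(congr1 (+%R^~ (f a))) := fs (Ordinal an).
by rewrite subrK /= => ->; rewrite IHa 1?ltnW // -[a.+1]add1n natrD mulrDl mul1r.
Qed.

(** The entries x_1, ..., x_r of an arm, continued by 0 at index 0 and by the
    value y of the hub from index r + 1 on. *)
Definition arm_coord {R : pzRingType} {r} (x : 'cV[R]_r) (y : R) (a : nat) : R :=
  if a is a'.+1 then oapp (fun i => x i 0) y (insub a') else 0.

Lemma arm_coordS (R : pzRingType) r (x : 'cV[R]_r) y (a : 'I_r) :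
  arm_coord x y a.+1 = x a 0.
Proof. by rewrite /arm_coord insubT ?ltn_ord //= => ar; congr (x _ 0); apply: val_inj. Qed.

Lemma arm_coord_end (R : pzRingType) r (x : 'cV[R]_r) y :
  arm_coord x y r.+1 = y.
Proof. by rewrite /arm_coord insubF // ltnn. Qed.

(** * The quadratic form of a weighted star *)

Section Star.
Variables (R : realFieldType) (m k : nat) (r : 'I_m -> nat).

Let B : 'M[R]_(\sum_(i < m) r i + 1) := map_mx intr (weighted_star k%:Z r).

Let arm (x : 'cV[R]_(\sum_(i < m) r i + 1)) (i : 'I_m) : 'cV[R]_(r i) :=
  submxcol (usubmx x) i.
Let hub (x : 'cV[R]_(\sum_(i < m) r i + 1)) : R := dsubmx x 0 0.

Definition star_defect : R := \sum_(i < m) 1 / ((r i)%:R + 1) - (m%:R - k%:R).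

Lemma star_sym : B^T = B.
Proof.
have -> : B^T = map_mx intr (weighted_star k%:Z r)^T.
  by apply/matrixP=> a b; rewrite !mxE.
congr map_mx.
rewrite /weighted_star tr_block_mx tr_mxdiag tr_mxcol tr_mxrow tr_scalar_mx.
congr block_mx; last by apply: eq_mxcol => i; rewrite trmxK.
apply: eq_mxdiag => i; apply/matrixP=> a b; rewrite !mxE eq_sym.
by rewrite orbC.
Qed.

Lemma star_blockE : B =
  block_mx (\mxdiag_(i < m) map_mx intr (cartanA (r i)))
           (\mxcol_(i < m) map_mx intr (last_negv (r i)))
           (\mxrow_(i < m) (map_mx intr (last_negv (r i)))^T) (k%:R)%:M.
Proof.
rewrite /B /weighted_star map_block_mx map_scalar_mx; congr block_mx.
- apply/matrixP=> a b; rewrite !mxE; case: ifP => _; last by rewrite !mxE.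
  by rewrite -[0 in RHS](map_mx0 intr) -map_conform_mx mxE.
- by apply/matrixP=> a b; rewrite !mxE.
- by apply/matrixP=> a b; rewrite !mxE.
Qed.

(** Summing [cartan_form] over the arms gives - m y^2, the hub gives k y^2, and
    the squared means of the increments give the terms y^2 / (r_i + 1): together
    they form the coefficient [star_defect] of y^2. *)
Lemma star_formE x :
  quad_form B x =
    \sum_i \sum_(a < (r i).+1)
      (arm_coord (arm x i) (hub x) a.+1 - arm_coord (arm x i) (hub x) a
        - hub x / (r i).+1%:R) ^+ 2
    + hub x ^+ 2 * star_defect.
Proof.
have armE i : arm x i = \col_(a < r i) arm_coord (arm x i) (hub x) a.+1.
  by apply/colP=> a; rewrite [RHS]mxE arm_coordS.
have armF i : quad_form (map_mx intr (cartanA (r i))) (arm x i)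
    + hub x * ((map_mx intr (last_negv (r i)))^T *m arm x i) 0 0 *+ 2 =
    \sum_(a < (r i).+1)
      (arm_coord (arm x i) (hub x) a.+1 - arm_coord (arm x i) (hub x) a
        - hub x / (r i).+1%:R) ^+ 2 + hub x ^+ 2 / (r i).+1%:R - hub x ^+ 2.
  have := @cartan_form R (arm_coord (arm x i) (hub x)) (r i) erefl.
  rewrite -armE sum_sqr_increments ?pnatr_eq0 //.
  by rewrite arm_coord_end.
have -> : quad_form B x =
    \sum_i (quad_form (map_mx intr (cartanA (r i))) (arm x i)
      + hub x * ((map_mx intr (last_negv (r i)))^T *m arm x i) 0 0 *+ 2)
    + k%:R * hub x ^+ 2.
  rewrite star_blockE.
  have xE : x = col_mx (\mxcol_i arm x i) (hub x)%:M.
    by rewrite /arm submxcolK /hub -mx11_scalar vsubmxK.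
  rewrite [in LHS]xE /quad_form tr_col_mx tr_mxcol tr_scalar_mx -mulmxA.
  rewrite mul_block_col mul_row_col mul_mxdiag_mxcol mul_mxrow_mxcol.
  rewrite !mulmxDr mul_mxrow_mxcol !mul_mx_scalar !mul_scalar_mx.
  rewrite -scalemxAr mul_mxrow_mxcol.
  have mxD (M N : 'M[R]_1) : (M + N) 0 0 = M 0 0 + N 0 0 by rewrite mxE.
  have mxZ a (M : 'M[R]_1) : (a *: M) 0 0 = a * M 0 0 by rewrite mxE.
  have crossE i : ((arm x i)^T *m map_mx intr (last_negv (r i))) 0 0 =
      ((map_mx intr (last_negv (r i)))^T *m arm x i) 0 0.
    by rewrite -[in RHS](trmxK (arm x i)) -trmx_mul [RHS]mxE.
  rewrite !(mxD, mxZ) [(_)%:M 0 0]mxE eqxx mulr1n !summxE big_split /=.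
  rewrite (eq_bigr _ (fun i _ => crossE i)) sumrMnl -mulr_sumr.
  rewrite (eq_bigr (fun i => quad_form (map_mx intr (cartanA (r i))) (arm x i))).
    by ring.
  by move=> i _; rewrite /quad_form mulmxA.
rewrite (eq_bigr _ (fun i _ => armF i)) sumrB big_split /= -mulr_sumr.
rewrite sumr_const card_ord -[_ *+ m]mulr_natl.
have -> : star_defect = \sum_i ((r i).+1%:R)^-1 - (m%:R - k%:R).
  by congr (_ - _); apply: eq_bigr => i _; rewrite natr1 div1r.
by ring.
Qed.

Definition star_null : 'cV[R]_(\sum_(i < m) r i + 1) :=
  col_mx (\mxcol_i \col_(a < r i) (a.+1%:R / (r i).+1%:R)) 1%:M.

Lemma star_null_gt0 j : 0 < star_null j 0.
Proof.
rewrite mxE; case: splitP => a _; rewrite !mxE.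
  by rewrite divr_gt0 ?ltr0n.
by rewrite ord1 ltr01.
Qed.

Lemma star_nullP x :
  (forall i (a : 'I_(r i).+1),
     arm_coord (arm x i) (hub x) a.+1 - arm_coord (arm x i) (hub x) a =
       hub x / (r i).+1%:R) <->
  x = hub x *: star_null.
Proof.
have armZ i (a : 'I_(r i)) :
    arm (hub x *: star_null) i a 0 = a.+1%:R * (hub x / (r i).+1%:R).
  rewrite /arm /star_null scale_col_mx col_mxKu.
  have -> : hub x *: (\mxcol_i \col_(a < r i) (a.+1%:R / (r i).+1%:R)
                       : 'cV[R]_(\sum_(i < m) r i)) =
      \mxcol_i (hub x *: \col_(a < r i) (a.+1%:R / (r i).+1%:R)).
    by apply/matrixP=> ? ?; rewrite !mxE.
  by rewrite mxcolK !mxE mulrCA.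
have n_neq0 i : (r i).+1%:R != 0 :> R by rewrite pnatr_eq0.
split=> [steady | xE i a].
  have xi i (a : 'I_(r i)) : arm x i a 0 = a.+1%:R * (hub x / (r i).+1%:R).
    rewrite -[LHS](arm_coordS _ _ _ (hub x)).
    rewrite (@constant_increments R _ (r i).+1 (hub x / (r i).+1%:R)) //.
    by rewrite ltnS ltnW.
  rewrite -[LHS]vsubmxK -[RHS]vsubmxK; congr col_mx.
    apply/mxcolP=> i; apply/colP=> a.
    by rewrite -/(arm x i) xi -armZ.
  rewrite [LHS]mx11_scalar -/(hub x) /star_null scale_col_mx col_mxKd.
  by rewrite scalemx1.
have fE b : (b <= (r i).+1)%N ->
    arm_coord (arm x i) (hub x) b = b%:R * (hub x / (r i).+1%:R).
  case: b => [|b]; first by rewrite mul0r.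
  rewrite ltnS leq_eqVlt => /orP[/eqP->|br].
    by rewrite arm_coord_end mulrC divfK.
  by rewrite (arm_coordS _ _ _ _ (Ordinal br)) [in LHS]xE armZ.
by rewrite !fE ?ltn_ord 1?ltnW // -mulrBl -natrB ?subSnn ?mul1r.
Qed.

Lemma hub_null : hub star_null = 1.
Proof. by rewrite /hub /star_null col_mxKd mxE. Qed.

(** All the squares in [star_formE] vanish at [star_null], where the hub is 1. *)
Lemma star_form_null : quad_form B star_null = star_defect.
Proof.
rewrite star_formE hub_null expr1n mul1r big1 ?add0r // => i _.
rewrite big1 // => a _.
have /star_nullP/(_ i a) : star_null = hub star_null *: star_null.
  by rewrite hub_null scale1r.
by rewrite hub_null => ->; rewrite subrr expr0n.
Qed.

Lemma star_form_eq0 x : 0 <= star_defect ->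
  quad_form B x = 0 -> x = hub x *: star_null /\ hub x ^+ 2 * star_defect = 0.
Proof.
move=> d_ge0 /eqP; rewrite star_formE.
have sq_ge0 j : 0 <= \sum_(a < (r j).+1)
    (arm_coord (arm x j) (hub x) a.+1 - arm_coord (arm x j) (hub x) a
      - hub x / (r j).+1%:R) ^+ 2.
  by apply: sumr_ge0 => b _; apply: sqr_ge0.
have sum_ge0 := sumr_ge0 (index_enum _) (fun j (_ : true) => sq_ge0 j).
have hub_ge0 : 0 <= hub x ^+ 2 * star_defect by rewrite mulr_ge0 ?sqr_ge0.
rewrite paddr_eq0 // => /andP[/eqP sum0 /eqP ->]; split=> //; apply/star_nullP=> i a.
move/(psumr_eq0P (fun j _ => sq_ge0 j)): sum0 => /(_ i isT) sumi0.
apply/eqP; rewrite -subr_eq0 -sqrf_eq0; apply/eqP.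
by apply: (psumr_eq0P _ sumi0) => // b _; apply: sqr_ge0.
Qed.

(** The form takes the value [star_defect] at [star_null], so semidefiniteness
    makes the defect nonnegative; a positive defect would leave no isotropic
    vector, hence no kernel. *)
Lemma star_affineP : affine_type B <-> star_defect = 0.
Proof.
split=> [[[_ psdB] rk1 _] | d0].
  have d_ge0 : 0 <= star_defect by rewrite -star_form_null.
  have: kermx B != 0 by rewrite -mxrank_eq0 rk1.
  case/rowV0Pn=> v /sub_kermxP vB v_neq0.
  have qv0 : quad_form B v^T = 0 by rewrite /quad_form trmxK vB mul0mx mxE.
  have [vE /eqP] := star_form_eq0 _ d_ge0 qv0.
  rewrite mulf_eq0 sqrf_eq0 => /orP[/eqP h0|/eqP //].
  by move: v_neq0; rewrite -[v]trmxK vE h0 scale0r trmx0 eqxx.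
have d_ge0 : 0 <= star_defect by rewrite d0.
apply: (@affine_type_isotropic _ _ _ star_null); first by rewrite addn1.
- split=> [|x]; first exact: star_sym.
  rewrite star_formE d0 mulr0 addr0.
  by apply: sumr_ge0 => i _; apply: sumr_ge0 => a _; apply: sqr_ge0.
- by move=> j; rewrite gt_eqF ?star_null_gt0.
move=> x; split=> [/(star_form_eq0 _ d_ge0)[xE _]|[c ->]]; first by exists (hub x).
by rewrite quad_formZ star_form_null d0 mulr0.
Qed.

End Star.

(** * The criterion and the bijection *)

(** The criterion is an equation between rationals, while the defect lives in
    the field of the quadratic form; the embedding of rat is injective. *)
Lemma sum_inv_ratr (R : numFieldType) m (c : rat) (n : 'I_m -> nat) :
  \sum_i 1 / ((n i)%:R + 1) = c <-> \sum_i 1 / ((n i)%:R + 1) = ratr c :> R.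
Proof.
have -> : \sum_i 1 / ((n i)%:R + 1) = ratr (\sum_i 1 / ((n i)%:R + 1)) :> R.
  rewrite rmorph_sum /=; apply: eq_bigr => i _.
  by rewrite fmorph_div rmorphD /= rmorph1 rmorph_nat.
by split=> [->|/fmorph_inj].
Qed.

Theorem corollary4p3 (R : realFieldType) (m k : nat)
    (hm : (2 <= m)%N) (hk : (0 < k)%N) :
  (forall r : 'I_m -> nat, (forall i, (0 < r i)%N) ->
     affine_type (map_mx (intr : int -> R) (weighted_star k%:Z r)) <->
     \sum_(i < m) 1 / ((r i)%:R + 1) = m%:R - k%:R :> rat)
  /\
  (forall p : int, p = m%:Z - k%:Z ->
     set_bij
       [set r : {ffun 'I_m -> nat} |
          (forall i, (0 < r i)%N) /\
          affine_type (map_mx (intr : int -> R) (weighted_star k%:Z r))]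
       [set N : {ffun 'I_m -> int} |
          (forall i, 2 <= N i) /\
          \sum_(i < m) 1 / (N i)%:~R = p%:~R :> rat]
       (fun r : {ffun 'I_m -> nat} => [ffun i => (r i)%:Z + 1])).
Proof.
have affP (r : 'I_m -> nat) :
    affine_type (map_mx (intr : int -> R) (weighted_star k%:Z r)) <->
    \sum_(i < m) 1 / ((r i)%:R + 1) = m%:R - k%:R :> rat.
  rewrite star_affineP (sum_inv_ratr R) rmorphB /= !ratr_nat /star_defect.
  by split=> [/eqP|->]; rewrite ?subrr // subr_eq0 => /eqP.
split=> [r _|p ->]; first exact: affP.
have sumE (r : {ffun 'I_m -> nat}) :
    \sum_(i < m) 1 / ([ffun i => (r i)%:Z + 1] i)%:~R =
    \sum_(i < m) 1 / ((r i)%:R + 1) :> rat.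
  by apply: eq_bigr => i _; rewrite ffunE rmorphD.
have pE : (m%:Z - k%:Z)%:~R = m%:R - k%:R :> rat by rewrite rmorphB.
split.
- move=> r [r_gt0 /affP sum_r]; split; last by rewrite sumE pE.
  by move=> i; rewrite ffunE -[2]/(1 + 1) lerD2r lez_nat r_gt0.
- move=> r s _ _ /ffunP rs; apply/ffunP=> i.
  by have := rs i; rewrite !ffunE => /addIr[].
- move=> N [N_ge2 sumN].
  have NE i : `|N i - 1|%N%:Z + 1 = N i.
    by rewrite gez0_abs ?subrK // subr_ge0 (le_trans _ (N_ge2 i)).
  have rE : [ffun i => ([ffun i => `|N i - 1|%N] i)%:Z + 1] = N.
    by apply/ffunP=> i; rewrite !ffunE NE.
  exists [ffun i => `|N i - 1|%N] => //; split.
    by move=> i; rewrite ffunE -ltz_nat -(ltrD2r 1) NE (lt_le_trans _ (N_ge2 i)).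
  by apply/affP; rewrite -sumE rE sumN.
Qed.
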